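(* Let $n>0$ and let $A_0,A_1,\dots,A_{n-1}$ and $B$ be rings such that $A_j\subset B$ (as a subring) for every $j\in\{0,1,\dots,n-1\}$ and such that $A_i\not\subset A_{i+1}$ for some index $i$ with $0\leq i\leq n-2$. Let $T'_n=A_0+A_1X+\dots+A_{n-1}X^{n-1}+X^nB[X]$. Then $(T'_n,\cdot)$ is not a semigroup, where $\cdot$ is the multiplication of $B[X]$.
   Context: Rings are commutative with unity (subrings share the unity). $A_0+A_1X+\dots+A_{n-1}X^{n-1}+X^nB[X]$ denotes the set of polynomials in $B[X]$ whose coefficient of $X^j$ lies in $A_j$ for $j=0,\dots,n-1$, the coefficients of $X^j$ with $j\geq n$ being arbitrary elements of $B$. Since multiplication in $B[X]$ is associative, ''not a semigroup'' means that $T'_n$ is not closed under multiplication. *)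

(* Defs.v *)
From HB Require Import structures.
From mathcomp Require Import all_boot all_algebra.
From mathcomp Require Import boolp classical_sets.

Set Implicit Arguments.
Unset Strict Implicit.
Unset Printing Implicit Defensive.

Import GRing.Theory.
Local Open Scope ring_scope.
Local Open Scope classical_set_scope.

(* A_0 + A_1 X + ... + A_(n-1) X^(n-1) + X^n B[X]. Coefficients beyond
   size p are 0, and coefficients of index >= n are unconstrained.
   {poly B} requires B to be nonzero; over the zero ring all the A_j coincide. *)
Definition composite_poly (B : comNzRingType) (n : nat) (A : 'I_n -> set B) :
    set {poly B} :=
  [set p | forall j : 'I_n, p`_j \in A j].

(* Main.v *)
(* If a lies in A_i but not in A_(i+1), then a X^i and X both lie in T'_n,
   while their product a X^(i+1) does not. *)

Require Import Defs.
From HB Require Import structures.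
From mathcomp Require Import all_boot all_algebra.
From mathcomp Require Import boolp classical_sets.

Set Implicit Arguments.
Unset Strict Implicit.
Unset Printing Implicit Defensive.

Import GRing.Theory.
Local Open Scope ring_scope.
Local Open Scope classical_set_scope.

(** Multiplication by ['X] shifts coefficients up one degree, so closure would force every [a] in
    [A i] into the next ring [A j]. Both factors [a *: 'X^i] and ['X] are admissible because each
    [A k] contains 0 and 1. *)

Theorem corollary2p3 (B : comNzRingType) (n : nat) (n_gt0 : (0 < n)%N)
    (A : 'I_n -> set B)
    (subringA : forall j : 'I_n, GRing.subring_closed (mem (A j)))
    (not_incl : exists i j : 'I_n,
       (j : nat) = i.+1 /\ ~ (A i `<=` A j)) :
  ~ GRing.mulr_2closed (mem (composite_poly A)).
Proof.
have A1 j : 1 \in A j by case: (subringA j).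
have A0 j : 0 \in A j.
  by case: (subringA j) => one_in sub_in _; rewrite -(subrr 1); apply: sub_in.
case: not_incl => i [j [eq_j not_sub]] mul_closed; apply: not_sub => a Aia.
have aXi_in : a *: 'X^i \in composite_poly A.
  apply/mem_set => k; rewrite coefZ coefXn.
  (* Only degree [i] carries a nonzero coefficient; [val_inj] lifts [k = i] from naturals to
     ordinals, so that [A k] becomes [A i]. *)
  have [/val_inj->|_] := eqVneq (k : nat) i; last by rewrite mulr0.
  by rewrite mulr1; apply/mem_set.
have X_in : 'X \in composite_poly A.
  by apply/mem_set => k; rewrite coefX; case: eqP.
(* The coefficient of the product at [j = i.+1] is [a] itself. *)
have /set_mem/(_ j) := mul_closed _ _ aXi_in X_in.
by rewrite coefMX eq_j /= coefZ coefXn eqxx mulr1 => /set_mem.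
Qed.
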